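(* Let $d\ge2$ and let $Y_1,\ldots,Y_n$ be random vectors in $\mathbb{R}^d$ which are exchangeable and almost surely in type $A$ general position. Then the dual Weyl cone $\mathcal{C}_n^A$ of type $A_{n-1}$ has the same distribution as $(\mathcal{D}_n^A)^\circ$, the dual cone of the Weyl random cone $\mathcal{D}_n^A$ of type $A_{n-1}$.
   Context: Type $A$ general position: vectors $y_1,\ldots,y_n\in\mathbb{R}^d$ are said to be in type $A$ general position if $n\ge d+1$ and, for every permutation $\sigma$ of $\{1,\ldots,n\}$, any $d$ of the vectors $y_{\sigma(1)}-y_{\sigma(2)},\ldots,y_{\sigma(n-1)}-y_{\sigma(n)}$ are linearly independent. Exchangeable means that $(Y_1,\ldots,Y_n)$ has the same distribution as $(Y_{\sigma(1)},\ldots,Y_{\sigma(n)})$ for every permutation $\sigma$ of $\{1,\ldots,n\}$. For $x\in\mathbb{R}^d\setminus\{0\}$ let $x^\perp=\{v\in\mathbb{R}^d:\langle v,x\rangle=0\}$. The Weyl tessellation $\mathcal{W}^A(y_1,\ldots,y_n)$ of type $A_{n-1}$ is the set of cones obtained as closures of the connected components of $\mathbb{R}^d\setminus\bigcup_{1\le i<j\le n}(y_i-y_j)^\perp$. The Weyl random cone $\mathcal{D}_n^A$ is obtained by choosing uniformly at random one of the cones of the random tessellation $\mathcal{W}^A(Y_1,\ldots,Y_n)$; that is, for a Borel set $\mathcal{B}$ of polyhedral cones, $\mathbb{P}(\mathcal{D}_n^A\in\mathcal{B})=\mathbb{E}\big[\frac{1}{\#\mathcal{W}^A(Y_1,\ldots,Y_n)}\sum_{C\in\mathcal{W}^A(Y_1,\ldots,Y_n)}\mathbf{1}_{\mathcal{B}}(C)\big]$.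 $\operatorname{pos}\{x_1,\ldots,x_m\}=\{\sum_i\lambda_ix_i:\lambda_i\ge0\}$. The dual Weyl cone $\mathcal{C}_n^A$ is the random cone whose distribution is that of $\operatorname{pos}\{Y_1-Y_2,\ldots,Y_{n-1}-Y_n\}$ conditioned on the event that this positive hull is not equal to $\mathbb{R}^d$. The dual of a cone $C\subset\mathbb{R}^d$ is $C^\circ=\{v\in\mathbb{R}^d:\langle x,v\rangle\le0\text{ for all }x\in C\}$. *)

(* Defs.v *)
From HB Require Import structures.
From mathcomp Require Import all_boot all_order all_algebra all_fingroup.
From mathcomp Require Import finmap.
From mathcomp Require Import all_classical all_reals all_analysis.

Set Implicit Arguments.
Unset Strict Implicit.
Unset Printing Implicit Defensive.

Import Order.TTheory GRing.Theory Num.Theory.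
Import numFieldNormedType.Exports.

Local Open Scope classical_set_scope.
Local Open Scope ring_scope.

(* R^d with its Borel sigma-algebra; this type is convertible to 'rV[R]_d. *)
Notation borel_rV R d := (g_sigma_algebraType (@open 'rV[R]_d)).

Section Cones.
Context {R : realType} {d : nat}.
Local Notation V := 'rV[R]_d.

Definition dotv (u v : V) : R := (u *m v^T) 0 0.

(* The norm `|u| of the library is the sup norm, not the Euclidean one. *)
Definition enorm (u : V) : R := Num.sqrt (dotv u u).

Definition orth (x : V) : set V := [set v | dotv v x = 0].

Definition pos_hull m (x : 'I_m -> V) : set V :=
  [set v | exists2 c : 'I_m -> R,
     forall i, 0 <= c i & v = \sum_(i < m) c i *: x i].

Definition dual_cone (C : set V) : set V :=
  [set v | forall x, C x -> dotv x v <= 0].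

Definition polyhedral_cone : set (set V) :=
  [set C | exists s : seq V, C = [set v | forall a, a \in s -> dotv v a <= 0]].

(* C and D meet the unit sphere in sets at Hausdorff distance at most e. If one
   of these sets is empty so is the other: {0} is an isolated cone. *)
Definition cone_close (e : R) (C D : set V) : Prop :=
  (forall u, C u -> enorm u = 1 ->
     exists v, [/\ D v, enorm v = 1 & enorm (u - v) <= e]) /\
  (forall v, D v -> enorm v = 1 ->
     exists u, [/\ C u, enorm u = 1 & enorm (u - v) <= e]).

Definition cone_open : set (set (set V)) :=
  [set U | U `<=` polyhedral_cone /\
     forall C, U C -> exists2 e, 0 < e &
       forall D, polyhedral_cone D -> cone_close e C D -> U D].

Definition cone_borel : set (set (set V)) := <<s polyhedral_cone, cone_open >>.

End Cones.

Lemma ltn_pred1 n (k : 'I_n.-1) : (k < n)%N.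
Proof. exact: leq_trans (ltn_ord k) (leq_pred n). Qed.

Lemma ltn_pred1S n (k : 'I_n.-1) : (k.+1 < n)%N.
Proof. by rewrite -ltn_predRL. Qed.

Section WeylTypeA.
Context {R : realType} {d n : nat}.
Local Notation V := 'rV[R]_d.
Implicit Type y : 'I_n -> V.

(* y_1 - y_2, ..., y_(n-1) - y_n, with indices shifted to start from 0. *)
Definition consec_diff y (k : 'I_n.-1) : V :=
  y (Ordinal (ltn_pred1 k)) - y (Ordinal (ltn_pred1S k)).

Definition general_position_A y : Prop :=
  (d.+1 <= n)%N /\
  forall (s : 'S_n) (f : 'I_d -> 'I_n.-1), injective f ->
    row_free (\matrix_(i < d) consec_diff (y \o s) (f i)).

Definition weyl_hyperplanes_A y : set V :=
  \bigcup_(p in [set p : 'I_n * 'I_n | (p.1 < p.2)%N]) orth (y p.1 - y p.2).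

Definition weyl_tessellation_A y : set (set V) :=
  [set closure (connected_component (~` weyl_hyperplanes_A y) x)
     | x in ~` weyl_hyperplanes_A y].

End WeylTypeA.

Section RandomCones.
Context {disp : measure_display} {T : measurableType disp} {R : realType}.
Context (P : probability T R).
Context {d n : nat}.
Context (Y : 'I_n -> {RV P >-> borel_rV R d}).

(* The product sigma-algebra on n-tuples is the library's instance. *)
Definition exchangeable : Prop :=
  forall (s : 'S_n) (A : set (n.-tuple (borel_rV R d))), measurable A ->
    P [set w | A [tuple Y i w | i < n]] =
    P [set w | A [tuple Y (s i) w | i < n]].

Definition sample (w : T) : 'I_n -> 'rV[R]_d := fun i => Y i w.

(* The distribution of the Weyl random cone, as a function of B. *)
Definition weyl_cone_law (B : set (set 'rV[R]_d)) : \bar R :=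
  let W w := weyl_tessellation_A (sample w) in
  ('E_P[fun w => ((#|` fset_set (W w)|%:R)^-1 *
                  \sum_(C \in W w) (\1_B C : R))%R])%E.

(* The distribution of the dual Weyl cone, as a function of B. *)
Definition dual_weyl_cone_law (B : set (set 'rV[R]_d)) : \bar R :=
  let hull w := pos_hull (consec_diff (sample w)) in
  (P [set w | B (hull w) /\ hull w <> setT] / P [set w | hull w <> setT])%E.

End RandomCones.

(* Main.v *)
Require Import Defs.
From mathcomp Require Import all_boot all_order all_algebra all_fingroup.
From mathcomp Require Import finmap.
From mathcomp Require Import all_classical all_reals all_analysis.
From mathcomp Require Import measurable_realfun measurable_fun_approximation.
From mathcomp Require Import zify ring lra.
Import Order.TTheory GRing.Theory Num.Theory.
Import numFieldNormedType.Exports.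
Local Open Scope classical_set_scope.
Local Open Scope ring_scope.

(** For an order [s] of the indices let [H_s] be the positive hull of the
    consecutive differences of the vectors [Y (s 0), Y (s 1), ...]. Its dual
    consists of the functionals [v] for which the values [<Y (s i), v>] are
    nondecreasing in [i]. A functional off all the hyperplanes orders the
    vectors strictly in exactly one way, so the cones of the Weyl tessellation
    are the duals of the [H_s] for the orders [s] realized by some functional
    ([weyl_tessellationE]). In general position these are the orders for which
    [H_s] is a proper cone ([pos_hull_neqTE]), and finitely generated cones are
    equal to their biduals ([dual_dual_pos_hull]). Hence, almost surely,
    summing the indicator of [B] over the duals of the cones of the tessellation
    amounts to summing the indicators of the events [H_s \in B, H_s <> R^d] over
    all orders [s] ([sum_weyl_tessellation_dual]).

    By exchangeability these [n`!] events have the same probability, so the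
    expectation of that sum is [n`!] times the numerator of the law of the dual
    Weyl cone. The denominator is the same quantity for the set of all cones,
    where the sum is the number of cones of the tessellation. What makes the two
    laws agree is that this number is a constant
    ([card_chambers_general_position]), so that dividing before or after taking
    expectations is the same.

    That constancy is proved by deletion-restriction ([ncells_cons]). The number
    of cells cut out by hyperplanes in a linear space depends only on which of
    the hyperplanes contain which of the intersections of others. For the
    hyperplanes orthogonal to differences of points, these intersections
    correspond to partitions of the points into classes of equal value; listing
    the points class after class shows that each intersection is defined by
    consecutive differences of one list ([level_space_sorted]). In general
    position any [d] of these are independent, so the dimension of an
    intersection, and thereby each inclusion, is determined by the partitions.

    The probabilities make sense because [H_s] is a measurable random cone
    ([measurable_hull]), whether or not the vectors are in general position. The
    sphere of directions is covered by finitely many small boxes; cones meeting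
    the same boxes are close to each other, and meeting a box is a countable
    condition on the generators of a hull. The Weyl tessellation is only
    understood in general position, so its contribution is handled up to null
    sets, without measurability ([le_integral_ae]). *)

Set Implicit Arguments.
Unset Strict Implicit.
Unset Printing Implicit Defensive.

(** * The inner product *)

Section InnerProduct.
Context {R : realType} {d : nat}.
Local Notation V := 'rV[R]_d.
Implicit Types u v w : V.

Lemma dotvE u v : dotv u v = \sum_j u 0 j * v 0 j.
Proof. by rewrite /dotv mxE; apply: eq_bigr => j _; rewrite mxE. Qed.

Lemma dotvC u v : dotv u v = dotv v u.
Proof. by rewrite !dotvE; apply: eq_bigr => j _; rewrite mulrC. Qed.

Lemma dotvDl u v w : dotv (u + v) w = dotv u w + dotv v w.
Proof. by rewrite /dotv mulmxDl mxE. Qed.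

Lemma dotvZl a u v : dotv (a *: u) v = a * dotv u v.
Proof. by rewrite /dotv -scalemxAl mxE. Qed.

Lemma dot0v v : dotv 0 v = 0.
Proof. by rewrite /dotv mul0mx mxE. Qed.

Lemma dotvNl u v : dotv (- u) v = - dotv u v.
Proof. by rewrite -scaleN1r dotvZl mulN1r. Qed.

Lemma dotvBl u v w : dotv (u - v) w = dotv u w - dotv v w.
Proof. by rewrite dotvDl dotvNl. Qed.

Lemma dotvDr u v w : dotv u (v + w) = dotv u v + dotv u w.
Proof. by rewrite !(dotvC u) dotvDl. Qed.

Lemma dotvZr a u v : dotv u (a *: v) = a * dotv u v.
Proof. by rewrite !(dotvC u) dotvZl. Qed.

Lemma dotvNr u v : dotv u (- v) = - dotv u v.
Proof. by rewrite !(dotvC u) dotvNl. Qed.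

Lemma dotv0 v : dotv v 0 = 0.
Proof. by rewrite dotvC dot0v. Qed.

Lemma dotvBr u v w : dotv u (v - w) = dotv u v - dotv u w.
Proof. by rewrite dotvDr dotvNr. Qed.

Lemma dotv_suml (I : finType) (F : I -> V) v :
  dotv (\sum_i F i) v = \sum_i dotv (F i) v.
Proof. by rewrite /dotv mulmx_suml summxE. Qed.

Lemma dotv_delta u j : dotv u (delta_mx 0 j) = u 0 j.
Proof.
rewrite dotvE (bigD1 j) //= big1 ?addr0 => [|i ij]; rewrite mxE eqxx /=.
  by rewrite eqxx mulr1.
by rewrite (negbTE ij) mulr0.
Qed.

Lemma dotvv_ge0 u : 0 <= dotv u u.
Proof. by rewrite dotvE sumr_ge0 // => i _; rewrite -expr2 sqr_ge0. Qed.

Lemma dotvv_eq0 u : (dotv u u == 0) = (u == 0).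
Proof.
apply/eqP/eqP => [|->]; last by rewrite dot0v.
rewrite dotvE => /psumr_eq0P => u0; apply/rowP => j; rewrite mxE.
have := u0 (fun i _ => _) j isT.
by move=> /(_ (fun i => sqr_ge0 (u 0 i)))/eqP; rewrite mulf_eq0 orbb => /eqP.
Qed.

Lemma dotvv_gt0 u : u != 0 -> 0 < dotv u u.
Proof. by move=> u0; rewrite lt_def dotvv_ge0 dotvv_eq0 u0. Qed.

Lemma dotv_continuous u : continuous (dotv u).
Proof.
have -> : dotv u = fun v : V => \sum_j u 0 j * v 0 j.
  by apply/funext => v; rewrite dotvE.
apply: (@continuous_big R^o _ +%R 0 xpredT) => [|j _ v].
  exact: add_continuous.
by apply: (@cvgM _ _ (nbhs v) _ (fun=> u 0 j)); [exact: cvg_cst|exact: coord_continuous].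
Qed.

End InnerProduct.

(** * Finitely generated cones are polyhedral *)

Section Duality.
Context {R : realType} {d : nat}.
Local Notation V := 'rV[R]_d.

Definition halfspaces (s : seq V) : set V :=
  [set v | forall a, a \in s -> dotv v a <= 0].

(** One step of Fourier-Motzkin elimination. If [C] is cut out by [s], a vector
    [v] lies in [C + R_+ x] when some [0 <= t] satisfies
    [<v, a> <= t <x, a>] for all [a] in [s]. The bounds on [t] are lower ones
    where [<x, a>] is positive and upper ones where it is negative; they are
    compatible with each other and with [0 <= t] when [v] satisfies the
    constraints listed here. *)
Definition fm_elim (x : V) (s : seq V) : seq V :=
  [seq a <- s | dotv x a <= 0] ++
  [seq dotv x a *: b - dotv x b *: a | a <- [seq a <- s | 0 < dotv x a],
                                       b <- [seq b <- s | dotv x b < 0]].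

Lemma exists_max_seq (l : seq R) :
  exists2 t, 0 <= t & (forall r, r \in l -> r <= t) /\ (t = 0 \/ t \in l).
Proof.
elim: l => [|r l [t t0 [tl tE]]]; first by exists 0 => //; split=> //; left.
have [rt|tr] := leP r t.
  exists t => //; split=> [q|]; first by rewrite inE => /predU1P[->|/tl].
  by case: tE => [->|tl']; [left|right; rewrite inE tl' orbT].
exists r; first exact: le_trans t0 (ltW tr).
split=> [q|]; last by right; rewrite mem_head.
by rewrite inE => /predU1P[->//|/tl/le_trans]; apply; exact: ltW.
Qed.

Lemma fm_elimP (x : V) (s : seq V) v :
  halfspaces (fm_elim x s) v <->
  exists2 t, 0 <= t & halfspaces s (v - t *: x).
Proof.
split=> [vs|[t t0 vs] a].
  (* the larger of [0] and the lower bounds *)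
- have [t t0 [tl tE]] :=
    exists_max_seq [seq dotv v a / dotv x a | a <- s & 0 < dotv x a].
  exists t => // a as_; rewrite dotvBl dotvZl subr_le0.
  have [xa|xa|xa] := ltgtP (dotv x a) 0.
  + case: tE => [->|/mapP[b]].
      rewrite mul0r; apply: vs.
      by rewrite mem_cat mem_filter (ltW xa) as_.
    rewrite mem_filter => /andP[xb bs] ->.
    have : dotv v (dotv x b *: a - dotv x a *: b) <= 0.
      apply: vs; rewrite mem_cat; apply/orP; right.
      apply/allpairsP; exists (b, a) => /=.
      by rewrite !mem_filter xa xb as_ bs.
    rewrite dotvBr !dotvZr subr_le0 => h.
    by rewrite mulrAC ler_pdivlMr// mulrC [leRHS]mulrC.
  + rewrite -ler_pdivrMr//; apply: tl; apply/mapP; exists a => //.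
    by rewrite mem_filter xa as_.
  + rewrite xa mulr0; apply: vs.
    by rewrite mem_cat mem_filter xa lexx as_.
- rewrite mem_cat => /orP[|/allpairsP[[b c] /= []]].
    rewrite mem_filter => /andP[xa /vs].
    rewrite dotvBl dotvZl subr_le0 => /le_trans; apply.
    by rewrite mulr_ge0_le0.
  rewrite !mem_filter => /andP[xb /vs vb] /andP[xc /vs vc] ->.
  move: vb vc; rewrite !dotvBl !dotvZl dotvBr !dotvZr !subr_le0 => vb vc.
  rewrite (@le_trans _ _ (dotv x b * (t * dotv x c)))//.
    by rewrite ler_wpM2l// ltW.
  have := ler_wnM2l (ltW xc) vb; congr (_ <= _); ring.
Qed.

Lemma pos_hullS m (x : 'I_m.+1 -> V) v :
  pos_hull x v <->
  exists2 t, 0 <= t & pos_hull (fun i => x (lift ord0 i)) (v - t *: x ord0).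
Proof.
split=> [[c c0 ->]|[t t0 [c c0 vE]]].
  exists (c ord0) => //; exists (fun i => c (lift ord0 i)) => //.
  by rewrite big_ord_recl addrAC subrr add0r.
exists (fun i => oapp c t (unlift ord0 i)).
  by move=> i; case: unliftP => [j|] _ //=.
rewrite big_ord_recl unlift_none /=.
under eq_bigr do rewrite liftK /=.
by rewrite -vE addrC subrK.
Qed.

(** Adding one generator to a cone preserves polyhedrality, by elimination of
    the coefficient of that generator (Minkowski-Weyl). *)
Lemma polyhedral_pos_hull m (x : 'I_m -> V) : polyhedral_cone (pos_hull x).
Proof.
suff [s sE] : exists s, pos_hull x = halfspaces s by exists s.
elim: m x => [|m ih] x.
  (* the cone [{0}] is cut out by the coordinates and their opposites *)
  exists ([seq delta_mx 0 j | j : 'I_d] ++ [seq - delta_mx 0 j | j : 'I_d]).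
  apply/seteqP; split=> v /=.
    by move=> [c _ ->]; rewrite big_ord0 => a _; rewrite dot0v.
  move=> vs; exists (fun=> 0) => //; rewrite big_ord0.
  apply/rowP => j; rewrite mxE -(dotv_delta v j).
  apply/eqP; rewrite eq_le -[X in _ && X]oppr_le0 -dotvNr.
  by apply/andP; split; apply: vs; rewrite mem_cat; apply/orP;
    [left|right]; apply/mapP; exists j; rewrite ?mem_enum.
have [s sE] := ih (fun i => x (lift ord0 i)).
exists (fm_elim (x ord0) s); apply/seteqP; split=> v.
  by move=> /pos_hullS; rewrite sE => /fm_elimP.
by move=> /fm_elimP; rewrite -sE => /pos_hullS.
Qed.

Lemma dual_pos_hull m (x : 'I_m -> V) :
  dual_cone (pos_hull x) = [set v | forall k, dotv (x k) v <= 0].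
Proof.
apply/seteqP; split=> v /= vx => [k|_ [c c0 ->]].
  apply: vx; exists (fun i => (i == k)%:R) => //.
  by rewrite (bigD1 k)//= eqxx scale1r big1 ?addr0// => i /negbTE->; rewrite scale0r.
by rewrite dotv_suml sumr_le0// => i _; rewrite dotvZl mulr_ge0_le0.
Qed.

Lemma polyhedral_dual_pos_hull m (x : 'I_m -> V) :
  polyhedral_cone (dual_cone (pos_hull x)).
Proof.
exists [seq x k | k : 'I_m]; rewrite dual_pos_hull; apply/seteqP; split=> v /= vx.
  by move=> _ /mapP[k _ ->]; rewrite dotvC.
by move=> k; rewrite dotvC vx//; apply/mapP; exists k; rewrite ?mem_enum.
Qed.

(** The normals defining the hull as an intersection of half-spaces belong to
    its dual, so whatever is polar to the dual satisfies these constraints. *)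
Lemma dual_dual_pos_hull m (x : 'I_m -> V) :
  dual_cone (dual_cone (pos_hull x)) = pos_hull x.
Proof.
have [s sE] := polyhedral_pos_hull x.
apply/seteqP; split=> v vx; last by move=> u /(_ _ vx); rewrite dotvC.
rewrite sE => a as_; rewrite dotvC; apply: vx => u.
by rewrite sE dotvC => /(_ _ as_); rewrite dotvC.
Qed.

(** Farkas' lemma: one of the constraints defining a proper cone is not void. *)
Lemma polyhedral_neqT (C : set V) :
  polyhedral_cone C -> C <> setT -> exists2 a, a != 0 & dual_cone C a.
Proof.
move=> [s ->] hT.
have [a as_ a0] : exists2 a, a \in s & a != 0.
  apply: contra_notP hT => s0; apply/seteqP; split=> // v _ a as_.
  have [->|a0] := eqVneq a 0; first by rewrite dotv0.
  by case: s0; exists a.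
by exists a => // v /(_ _ as_).
Qed.

End Duality.

(** * Counting the cells of an arrangement *)

Section Cells.
Context {R : realType} {d : nat}.
Local Notation V := 'rV[R]_d.
Implicit Types (a b u v w : V) (s bs : seq V) (U D : set V).

Definition pos_side a : set V := [set v | 0 < dotv a v].
Definition neg_side a : set V := [set v | dotv a v < 0].

(** The number of nonempty cells into which the hyperplanes orthogonal to the
    members of [s] cut [D]. Being additive over the two sides of a hyperplane,
    it turns statements about arrangements into inductions on [s]. *)
Fixpoint ncells s D : nat :=
  if s is a :: s' then
    (ncells s' (D `&` pos_side a) + ncells s' (D `&` neg_side a))%N
  else `[< D !=set0 >].

Lemma ncells_set0 s : ncells s set0 = 0%N.
Proof.
elim: s => [|a s ih] /=; first by apply/eqP; rewrite eqb0; apply/asboolPn => -[].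
by rewrite !set0I ih.
Qed.

Definition cuts bs : set V := [set v | forall b, b \in bs -> 0 < dotv b v].

Lemma cuts_cons b bs : cuts (b :: bs) = cuts bs `&` pos_side b.
Proof.
apply/seteqP; split=> v /= vb.
  by split=> [c cb|]; apply: vb; rewrite inE ?cb ?orbT ?eqxx.
by move=> c; rewrite inE => /predU1P[->|]; case: vb => // + _; exact.
Qed.

Lemma neg_sideN a : neg_side a = pos_side (- a).
Proof. by apply/funext => v; rewrite /neg_side /pos_side /= dotvNl oppr_gt0. Qed.

(** [cuts bs] is open along every line; this is all the topology that counting
    cells requires. *)
Lemma cuts_open bs v w : cuts bs v ->
  exists2 e, 0 < e & cuts bs (v + e *: w) /\ cuts bs (v - e *: w).
Proof.
move=> vb.
suff [e e0 h] : exists2 e, 0 < e &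
    forall b, b \in bs -> e * `|dotv b w| < dotv b v.
  exists e => //; split=> b /h; rewrite ?dotvBr ?dotvDr dotvZr => {}h.
    rewrite -ltrBlDr sub0r (le_lt_trans _ h)//.
    by rewrite -mulrN ler_wpM2l ?(ltW e0)// -normrN ler_norm.
  by rewrite subr_gt0 (le_lt_trans _ h)// ler_wpM2l ?(ltW e0)// ler_norm.
elim: bs vb => [|b bs ih]; first by exists 1.
rewrite cuts_cons => -[/ih[e e0 he] vb].
pose e' := dotv b v / (`|dotv b w| + 1).
have w0 : 0 < `|dotv b w| + 1 by rewrite ltr_wpDl.
have e'0 : 0 < e' by rewrite divr_gt0.
exists (Num.min e e'); first by rewrite lt_min e0.
move=> c; rewrite inE => /predU1P[->|/he].
  rewrite (@le_lt_trans _ _ (e' * `|dotv b w|))//.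
    by rewrite ler_wpM2r// ge_min lexx orbT.
  by rewrite /e' mulrAC ltr_pdivrMr// ltr_pM2l// ltrDl.
by apply: le_lt_trans; rewrite ler_wpM2r// ge_min lexx.
Qed.

Definition linear_set U := forall u v t, U u -> U v -> U (u + t *: v).

(** Deletion-restriction: a hyperplane splits precisely the cells that it
    meets, and it meets each of them along one cell of the arrangement induced
    on it. Keeping track of the cell to be cut as [U `&` cuts bs] makes the
    induction reduce to a single cell: it is convex, so it has points on the
    hyperplane if it has points on both sides; it is open in [U], so it has
    points on both sides if it has points on the hyperplane. *)
Lemma ncells_split U a w : linear_set U -> U w -> dotv a w != 0 ->
  forall s bs, let D := U `&` cuts bs in
  (ncells s (D `&` pos_side a) + ncells s (D `&` neg_side a) =
   ncells s D + ncells s (D `&` orth a))%N.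
Proof.
move=> hU Uw aw; elim=> [|b s ih] bs D /=; last first.
  have DC c E : D `&` E `&` pos_side c = (U `&` cuts (c :: bs)) `&` E.
    by rewrite cuts_cons setIAC setIA.
  have DcE c : D `&` pos_side c = U `&` cuts (c :: bs).
    by rewrite cuts_cons setIA.
  rewrite !(neg_sideN b) !DC !DcE addnACA ih ih.
  by rewrite addnACA.
have mem0 : D `&` orth a !=set0 ->
    D `&` pos_side a !=set0 /\ D `&` neg_side a !=set0.
  move=> [v [[Uv vb] av]].
  have [e e0 [ep en]] := cuts_open w vb.
  have Up : (U `&` cuts bs) (v + e *: w) by split=> //; exact: hU.
  have Un : (U `&` cuts bs) (v - e *: w).
    by split=> //; rewrite -scaleNr; exact: hU.
  have {}av : dotv a v = 0 by rewrite dotvC.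
  have := aw; rewrite neq_lt => /orP[aw'|aw'].
    split; [exists (v - e *: w)|exists (v + e *: w)]; split=> //;
      rewrite /pos_side /neg_side /= ?dotvBr ?dotvDr dotvZr av ?sub0r ?add0r.
      by rewrite oppr_gt0 pmulr_rlt0.
    by rewrite pmulr_rlt0.
  split; [exists (v + e *: w)|exists (v - e *: w)]; split=> //;
    rewrite /pos_side /neg_side /= ?dotvBr ?dotvDr dotvZr av ?sub0r ?add0r.
    by rewrite pmulr_rgt0.
  by rewrite oppr_lt0 pmulr_rgt0.
have [D0|nD0] := pselect (D `&` orth a !=set0).
  have [Dp Dn] := mem0 D0; have Dd : D !=set0 by case: D0 => v [Dv _]; exists v.
  by rewrite !asboolT.
have convex : D `&` pos_side a !=set0 -> D `&` neg_side a !=set0 -> False.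
  move=> [u [[Uu ub]]]; rewrite /pos_side /= => au.
  move=> [v [[Uv vb]]]; rewrite /neg_side /= => av; apply: nD0.
  exists (u - (dotv a u / dotv a v) *: v); split.
    split; first by rewrite -scaleNr; exact: hU.
    move=> b bbs; rewrite dotvBr dotvZr -mulNr addr_gt0 ?ub// mulr_gt0 ?vb//.
    by rewrite oppr_gt0 pmulr_rlt0// invr_lt0.
  by rewrite /orth /= dotvC dotvBr dotvZr divfK ?subrr// lt_eqF.
rewrite (asboolF nD0) addn0.
have [Dp|nDp] := pselect (D `&` pos_side a !=set0).
  have nDn : ~ (D `&` neg_side a !=set0) by move=> /(convex Dp).
  by rewrite (asboolT Dp) (asboolF nDn) asboolT//; case: Dp => v [Dv _]; exists v.
rewrite (asboolF nDp) add0n; congr (nat_of_bool _); apply: asbool_equiv_eq.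
split=> [[v [Dv _]]|[v Dv]]; exists v => //; split=> //.
rewrite /neg_side /= ltNge le_eqVlt; apply/negP => /orP[|av].
  by move=> /eqP av; apply: nD0; exists v; split=> //; rewrite /orth /= dotvC.
by apply: nDp; exists v.
Qed.

(** Starting from a linear space, the number of cells is therefore governed by
    the sole question whether a hyperplane contains a given flat. *)
Lemma ncells_cons U a s : linear_set U ->
  ncells (a :: s) U = if `[< U `<=` orth a >] then 0%N
                      else (ncells s U + ncells s (U `&` orth a))%N.
Proof.
move=> hU; case: asboolP => [aU|naU] /=.
  have -> : U `&` pos_side a = set0.
    apply/seteqP; split=> // v [/aU]; rewrite /orth /pos_side /= dotvC => ->.
    by rewrite ltxx.
  have -> : U `&` neg_side a = set0.
    apply/seteqP; split=> // v [/aU]; rewrite /orth /neg_side /= dotvC => ->.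
    by rewrite ltxx.
  by rewrite ncells_set0.
have [w Uw aw] : exists2 w, U w & dotv a w != 0.
  apply: contra_notP naU => aU v Uv; rewrite /orth /= dotvC.
  by apply/eqP; apply: contra_notT aU => av; exists v.
have := ncells_split hU Uw aw s [::].
by have -> : U `&` cuts [::] = U by apply/seteqP; split=> [v []|v Uv].
Qed.

(** A hyperplane sorts the sets [E i] according to the side on which they lie,
    so the number of those that meet [D] satisfies the recursion of [ncells].
    Once all hyperplanes have been used, separation leaves at most one set and
    covering leaves at least one if [D] is not empty. *)
Lemma ncells_card (I : finType) (E : I -> set V) s D :
  (forall i a, a \in s -> E i `<=` pos_side a \/ E i `<=` neg_side a) ->
  (forall v, D v -> (forall a, a \in s -> dotv a v != 0) -> exists i, E i v) ->
  (forall i j, i != j -> D `&` E i !=set0 -> D `&` E j !=set0 ->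
     exists2 a, a \in s & ~ (E i `|` E j `<=` pos_side a) /\
                          ~ (E i `|` E j `<=` neg_side a)) ->
  ncells s D = #|[pred i | `[< D `&` E i !=set0 >]]|.
Proof.
elim: s D => [|a s ih] D side cover sep /=.
  have [[v Dv]|D0] := pselect (D !=set0); last first.
    rewrite asboolF//.
    by rewrite eq_card0// => i; rewrite inE; apply/asboolPn => -[v [? _]]; apply: D0; exists v.
  have [i Ei] := cover v Dv (fun _ => ltac:(by [])).
  rewrite asboolT; last by exists v.
  apply: (etrans (esym (card1 i))); apply: eq_card => j.
  rewrite !inE; apply/eqP/asboolP => [->|Ej]; first by exists v.
  by apply/eqP; apply/negPn/negP => ji; have [] := sep j i ji Ej; first by exists v.
have side' i b : b \in s -> E i `<=` pos_side b \/ E i `<=` neg_side b.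
  by move=> bs; apply: side; rewrite inE bs orbT.
have cover' H : (forall v, H v -> dotv a v != 0) ->
    forall v, (D `&` H) v -> (forall b, b \in s -> dotv b v != 0) -> exists i, E i v.
  move=> H0 v [Dv Hv] vs; apply: cover => // b.
  by rewrite inE => /predU1P[->|/vs//]; exact: H0.
have sep' H : (H = pos_side a \/ H = neg_side a) -> forall i j, i != j ->
    D `&` H `&` E i !=set0 -> D `&` H `&` E j !=set0 ->
    exists2 b, b \in s & ~ (E i `|` E j `<=` pos_side b) /\
                         ~ (E i `|` E j `<=` neg_side b).
  move=> Ha i j ij [u [[Du Hu] Eu]] [v [[Dv Hv] Ev]].
  have [||b + hb] := sep i j ij; [by exists u|by exists v|].
  rewrite inE => /predU1P[ba|]; last by exists b.
  exfalso; move: hb; rewrite ba => -[np nn].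
  have sd k := side k a (mem_head _ _).
  case: Ha Hu Hv => ->; rewrite /pos_side/neg_side/= => Hu Hv.
    apply: np => w [].
      by case: (sd i) => [/(_ w)//|/(_ u Eu)]; rewrite /neg_side/= => /(lt_trans Hu); rewrite ltxx.
    by case: (sd j) => [/(_ w)//|/(_ v Ev)]; rewrite /neg_side/= => /(lt_trans Hv); rewrite ltxx.
  apply: nn => w [].
    by case: (sd i) => [/(_ u Eu)|/(_ w)//]; rewrite /pos_side/= => /(lt_trans Hu); rewrite ltxx.
  by case: (sd j) => [/(_ v Ev)|/(_ w)//]; rewrite /pos_side/= => /(lt_trans Hv); rewrite ltxx.
rewrite (ih (D `&` pos_side a))//; [|by apply: cover' => v; rewrite /pos_side/=; apply: lt0r_neq0
  |by apply: sep'; left].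
rewrite (ih (D `&` neg_side a))//; [|by apply: cover' => v; rewrite /neg_side/=; apply: ltr0_neq0
  |by apply: sep'; right].
rewrite -!sum1_card [RHS](bigID [pred i | `[< E i `<=` pos_side a >]])/=; congr (_ + _)%N.
  apply: eq_bigl => i; rewrite inE; apply/asboolP/andP => [[v [[Dv av] Ev]]|[]].
    split; first by apply/asboolP; exists v.
    apply/asboolP; case: (side i a (mem_head _ _)) => // /(_ v Ev).
    by rewrite /neg_side/= => /(lt_trans av); rewrite ltxx.
  by move=> /asboolP[v [Dv Ev]] /asboolP Ei; exists v; do 2?split=> //; exact: Ei.
apply: eq_bigl => i; rewrite inE; apply/asboolP/andP => [[v [[Dv av] Ev]]|[]].
  split; first by apply/asboolP; exists v.
  by apply/asboolPn => /(_ v Ev); rewrite /pos_side/= => /(lt_trans av); rewrite ltxx.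
move=> /asboolP[v [Dv Ev]] /asboolPn Ei; exists v; do 2?split=> //.
by case: (side i a (mem_head _ _)) => //; exact.
Qed.

End Cells.

(** * Orderings of finitely many points *)

Lemma exists_card_set (I : finType) (A B : {set I}) m : A \subset B ->
  (#|A| <= m)%N -> (m <= #|B|)%N ->
  exists G : {set I}, [/\ A \subset G, G \subset B & #|G| = m].
Proof.
move=> AB Am mB.
have : (0 < #|[set G : {set I} | G \subset B :\: A & #|G| == (m - #|A|)%N]|)%N.
  by rewrite cards_draws bin_gt0 cardsD (finset.setIidPr AB) leq_sub2r.
move=> /card_gt0P[G]; rewrite inE => /andP[GBA /eqP Gm].
exists (A :|: G); split; first exact: finset.subsetUl.
  by rewrite finset.subUset AB (fintype.subset_trans GBA (finset.subsetDl _ _)).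
rewrite cardsU Gm (_ : A :&: G = finset.set0) ?cards0 ?subn0 ?subnKC//.
apply/finset.setP => x; rewrite !inE; apply/andP => -[xA /(fintype.subsetP GBA)].
by rewrite inE xA.
Qed.

Lemma sorting_perm (disp : Order.disp_t) (T : orderType disp) n (g : 'I_n -> T) :
  exists s : 'S_n, forall a b : 'I_n, (a <= b)%N -> (g (s a) <= g (s b))%O.
Proof.
pose leg := [rel i j | (g i <= g j)%O].
have leg_total : total leg by move=> i j; exact: le_total.
have leg_trans : transitive leg by move=> i j k; exact: le_trans.
have /tuple_permP[s sE] : perm_eq (sort leg (ord_tuple n)) (ord_tuple n).
  by rewrite perm_sort.
exists s => a b ab.
have nthE (i : 'I_n) : nth a (sort leg (ord_tuple n)) i = s i.
  rewrite sE (nth_map i) ?size_enum_ord//.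
  by rewrite nth_ord_enum tnth_ord_tuple.
rewrite -!nthE.
apply: (sorted_leq_nth leg_trans (fun i => lexx (g i)) a (sort_sorted leg_total _)) => //;
  by rewrite inE size_sort size_enum_ord.
Qed.

(** A transitive relation is checked on consecutive indices; the differences of
    a configuration are only given for these. *)
Lemma consec_trans n (r : 'I_n -> 'I_n -> Prop) :
  (forall i j k, r i j -> r j k -> r i k) ->
  (forall k : 'I_n.-1, r (Ordinal (ltn_pred1 k)) (Ordinal (ltn_pred1S k))) ->
  forall a b : 'I_n, (a < b)%N -> r a b.
Proof.
move=> rtr rS a [b bn] /=.
elim: b bn => [//|b ih] bn; rewrite ltnS leq_eqVlt => /predU1P[ab|ab].
  have bn' : (b < n.-1)%N by rewrite ltn_predRL.
  have := rS (Ordinal bn'); congr r; exact: val_inj.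
apply: rtr (ih (ltnW bn) ab) _.
have bn' : (b < n.-1)%N by rewrite ltn_predRL.
have := rS (Ordinal bn'); congr r; exact: val_inj.
Qed.

(** A list is determined by its elements once it is sorted by a strict order. *)
Lemma sorting_perm_uniq n (r : rel 'I_n) (s t : 'S_n) :
  transitive r -> irreflexive r ->
  (forall a b : 'I_n, (a < b)%N -> r (s a) (s b)) ->
  (forall a b : 'I_n, (a < b)%N -> r (t a) (t b)) -> s = t.
Proof.
move=> rtr rirr hs ht.
have srt (u : 'S_n) : (forall a b : 'I_n, (a < b)%N -> r (u a) (u b)) ->
    sorted r [seq u i | i <- enum 'I_n].
  move=> hu; rewrite sorted_map.
  have : sorted ltn (map val (enum 'I_n)) by rewrite val_enum_ord iota_ltn_sorted.
  by rewrite sorted_map; apply: sub_sorted => i j; exact: hu.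
have mem (u : 'S_n) i : i \in [seq u i | i <- enum 'I_n].
  by rewrite -[i](permKV u) map_f// mem_enum.
have E := irr_sorted_eq rtr rirr (srt _ hs) (srt _ ht) (fun i => etrans (mem s i) (esym (mem t i))).
by apply/permP => i; move/eq_in_map: E => /(_ i); rewrite mem_enum => /(_ isT).
Qed.

(** * Chambers *)

Section Chambers.
Context {R : realType} {n : nat}.

Section OneConfiguration.
Context {d : nat}.
Local Notation V := 'rV[R]_d.
Implicit Types (y : 'I_n -> V) (s : 'S_n) (c : 'I_n -> 'I_n).

(** The functionals that list the points [y] in increasing order. *)
Definition chamber y : set V := [set v | forall k, dotv (consec_diff y k) v < 0].

Lemma chamberP y v :
  chamber y v <-> forall a b : 'I_n, (a < b)%N -> dotv (y a) v < dotv (y b) v.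
Proof.
split=> [vy a b|vy k]; last by rewrite dotvBl subr_lt0 vy /=.
apply: (@consec_trans _ (fun a b => dotv (y a) v < dotv (y b) v)).
  by move=> i j k; exact: lt_trans.
by move=> k; rewrite -subr_lt0 -dotvBl; exact: vy.
Qed.

Definition index_pairs : seq ('I_n * 'I_n) :=
  [seq p : 'I_n * 'I_n <- enum {: 'I_n * 'I_n} | (p.1 < p.2)%N].

Definition pair_diffs y (ps : seq ('I_n * 'I_n)) : seq V :=
  [seq y p.1 - y p.2 | p <- ps].

Lemma mem_pair_diffs y (i j : 'I_n) : (i < j)%N -> y i - y j \in pair_diffs y index_pairs.
Proof.
by move=> ij; apply/mapP; exists (i, j) => //; rewrite mem_filter ij mem_enum.
Qed.

Lemma dotv_perm_neq y s v i j : chamber (y \o s) v -> i != j ->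
  dotv (y i) v != dotv (y j) v.
Proof.
move=> /chamberP vy; rewrite -[i](permKV s) -[j](permKV s) (inj_eq perm_inj).
rewrite -val_eqE /= neq_ltn => /orP[/vy|/vy] /=.
  by move=> /lt_eqF ->.
by move=> /gt_eqF ->.
Qed.

Lemma exists_chamber y v :
  (forall i j, i != j -> dotv (y i) v != dotv (y j) v) ->
  exists s, chamber (y \o s) v.
Proof.
move=> vy; have [s sv] := sorting_perm (fun i => dotv (y i) v).
exists s; apply/chamberP => a b ab; rewrite lt_neqAle; apply/andP; split.
  by apply: vy; rewrite (inj_eq perm_inj) neq_ltn ab.
exact: (sv a b (ltnW ab)).
Qed.

Lemma chamber_side y s i j : i != j ->
  chamber (y \o s) `<=` pos_side (y i - y j) \/
  chamber (y \o s) `<=` neg_side (y i - y j).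
Proof.
rewrite -[i](permKV s) -[j](permKV s) (inj_eq perm_inj) -val_eqE /= neq_ltn.
move=> /orP[ij|ij]; [right|left] => v /chamberP/(_ _ _ ij) /=.
  by rewrite /neg_side /= dotvBl subr_lt0.
by rewrite /pos_side /= dotvBl subr_gt0.
Qed.

(** A functional separating the points orders them in a single way. *)
Lemma chamber_perm_inj y s (t : 'S_n) u v : chamber (y \o s) u -> chamber (y \o t) v ->
  (forall i j, dotv (y i) v < dotv (y j) v -> dotv (y i) u < dotv (y j) u) ->
  s = t.
Proof.
move=> /chamberP su /chamberP tv h.
apply: (@sorting_perm_uniq _ [rel i j | dotv (y i) u < dotv (y j) u]).
- by move=> i j k /=; exact: lt_trans.
- by move=> i /=; rewrite ltxx.
- by move=> a b /su.
- by move=> a b /tv /h.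
Qed.

(** The chambers [chamber (y \o s)] are the cells of the arrangement of the
    hyperplanes [orth (y i - y j)]: two functionals with the same signs on all
    differences order the points in the same way. *)
Lemma card_chambers y :
  #|[pred s : 'S_n | `[< chamber (y \o s) !=set0 >]]| =
  ncells (pair_diffs y index_pairs) setT.
Proof.
rewrite (@ncells_card _ _ _ (fun s => chamber (y \o s))).
- by apply: eq_card => s; rewrite !inE setTI.
- move=> s a /mapP[[i j]]; rewrite mem_filter /= => /andP[ij _] ->.
  by apply: chamber_side; rewrite neq_ltn ij.
- move=> v _ vs; apply: exists_chamber => i j; rewrite -val_eqE neq_ltn => /orP[ij|ij].
    by have := vs _ (mem_pair_diffs y ij); rewrite dotvBl subr_eq0.
  by have := vs _ (mem_pair_diffs y ij); rewrite dotvBl subr_eq0 eq_sym.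
- move=> s t st; rewrite !setTI => -[u su] [v tv].
  apply: contrapT => same.
  have {}same (i j : 'I_n) : (i < j)%N ->
      chamber (y \o s) `|` chamber (y \o t) `<=` pos_side (y i - y j) \/
      chamber (y \o s) `|` chamber (y \o t) `<=` neg_side (y i - y j).
    move=> ij; apply: contrapT => /not_orP nn.
    by apply: same; exists (y i - y j) => //; exact: mem_pair_diffs.
  move/eqP: st; apply; apply: (chamber_perm_inj su tv) => i j.
  have [->|] := eqVneq i j; first by rewrite ltxx.
  rewrite -val_eqE /= neq_ltn => /orP[ij|ij].
    have [h|h] := same _ _ ij.
      have := h v (or_intror tv); rewrite /pos_side /= dotvBl subr_gt0.
      by move=> /lt_trans h1 /h1; rewrite ltxx.
    by have := h u (or_introl su); rewrite /neg_side /= dotvBl subr_lt0.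
  have [h|h] := same _ _ ij.
    by have := h u (or_introl su); rewrite /pos_side /= dotvBl subr_gt0.
  have := h v (or_intror tv); rewrite /neg_side /= dotvBl subr_lt0.
  by move=> /lt_trans h1 /h1; rewrite ltxx.
Qed.

(** The flats of the arrangement. A flat is encoded by labels on the points,
    equal labels forcing equal values; intersecting it with one more hyperplane
    amounts to merging two labels. The labels make sense for all
    configurations of [n] points at the same time. *)
Definition level_space y c : set V :=
  [set v | forall i j, c i = c j -> dotv (y i) v = dotv (y j) v].

Definition merge c (p q : 'I_n) : 'I_n -> 'I_n :=
  fun i => if c i == c p then c q else c i.

Lemma level_space_merge y c p q :
  level_space y (merge c p q) = level_space y c `&` orth (y p - y q).
Proof.
apply/seteqP; split=> v /=.
  move=> vc; split=> [i j ij|]; first by apply: vc; rewrite /merge ij.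
  rewrite /orth /= dotvC dotvBl (vc p q) ?subrr// /merge eqxx.
  by case: ifP.
move=> [vc]; rewrite /orth /= dotvC dotvBl => /eqP; rewrite subr_eq0 => /eqP pq i j.
rewrite /merge; case: eqP => ip; case: eqP => jp ij.
- by apply: vc; rewrite ip jp.
- by rewrite (vc _ _ ip) pq; exact: vc.
- by rewrite (vc _ _ jp) pq; exact: vc.
- exact: vc.
Qed.

Lemma linear_level_space y c : linear_set (level_space y c).
Proof.
move=> u v t uc vc i j ij.
by rewrite !dotvDr !dotvZr (uc _ _ ij) (vc _ _ ij).
Qed.

Definition kernel_at y s (F : {set 'I_n.-1}) : set V :=
  [set v | forall k, k \in F -> dotv (consec_diff (y \o s) k) v = 0].

End OneConfiguration.

(** Listing the points label after label makes the differences of consecutive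
    points with a common label span all differences of points with a common
    label. The listing depends on the labels only. *)
Lemma level_space_sorted (c : 'I_n -> 'I_n) :
  exists (s : 'S_n) (F : {set 'I_n.-1}), forall d (y : 'I_n -> 'rV[R]_d),
    level_space y c = kernel_at y s F.
Proof.
have [s sc] := sorting_perm c.
exists s, [set k | c (s (Ordinal (ltn_pred1 k))) == c (s (Ordinal (ltn_pred1S k)))]%SET.
move=> d y; apply/seteqP; split=> v vc.
  move=> k; rewrite inE => /eqP ck.
  by rewrite /consec_diff /= dotvBl (vc _ _ ck) subrr.
pose r (a b : 'I_n) := (a <= b)%N /\
  (c (s a) = c (s b) -> dotv (y (s a)) v = dotv (y (s b)) v).
have rP : forall a b : 'I_n, (a < b)%N -> r a b.
  apply: consec_trans => [i j k [ij hij] [jk hjk]|k].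
    split=> [|ik]; first exact: leq_trans jk.
    have cij : c (s i) = c (s j).
      by apply/le_anti; rewrite sc//= ik sc.
    by rewrite hij// hjk// -cij.
  split=> [|ck]; first exact: leqnSn.
  have := vc k; rewrite inE ck eqxx => /(_ isT)/eqP.
  by rewrite /consec_diff /= dotvBl subr_eq0 => /eqP.
move=> i j; rewrite -[i](permKV s) -[j](permKV s).
have [ij|ij|/val_inj ->//] := ltngtP ((s^-1)%g i) ((s^-1)%g j).
  by move=> /(rP _ _ ij).2.
by move=> /esym /(rP _ _ ij).2.
Qed.

(** By deletion-restriction, two configurations with the same inclusions of flats
    in hyperplanes have equally many cells. *)
Lemma ncells_level_space d e (y : 'I_n -> 'rV[R]_d) (z : 'I_n -> 'rV[R]_e) :
  (forall c p q, level_space y c `<=` orth (y p - y q) <->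
                 level_space z c `<=` orth (z p - z q)) ->
  forall ps c, ncells (pair_diffs y ps) (level_space y c) =
               ncells (pair_diffs z ps) (level_space z c).
Proof.
move=> yz; elim=> [|[p q] ps ih] c /=.
  by rewrite !asboolT//; exists 0 => i j _; rewrite !dotv0.
rewrite -!/(ncells (_ :: _) _) -/(pair_diffs y ps) -/(pair_diffs z ps).
have := ncells_cons (y p - y q) (pair_diffs y ps) (@linear_level_space _ y c).
have := ncells_cons (z p - z q) (pair_diffs z ps) (@linear_level_space _ z c).
move=> /= -> ->; rewrite -!level_space_merge !ih.
by rewrite (asbool_equiv_eq (yz c p q)).
Qed.

(** * General position *)

Section GeneralPosition.
Context {d : nat} (y : 'I_n -> 'rV[R]_d) (ygp : general_position_A y).
Implicit Types (s : 'S_n) (F G : {set 'I_n.-1}).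

Definition diff_span s F : 'M[R]_d :=
  (\sum_(k in F) <<consec_diff (y \o s) k>>)%MS.

Lemma kernel_at_diff_span s F v :
  kernel_at y s F v <-> diff_span s F *m v^T = 0.
Proof.
have kE k : (<<consec_diff (y \o s) k>> <= kermx v^T)%MS =
            (dotv (consec_diff (y \o s) k) v == 0).
  rewrite genmxE sub_kermx; apply/eqP/eqP => [h|h]; first by rewrite /dotv h mxE.
  by apply/rowP => i; rewrite ord1 [RHS]mxE.
rewrite (rwP eqP) -sub_kermx -(rwP sumsmx_subP).
by split=> h k /h; rewrite kE => /eqP.
Qed.

(** Annihilators reverse inclusions; the test vectors are the columns of a
    cokernel matrix. *)
Lemma kernel_at_sub s F s' F' :
  kernel_at y s F `<=` kernel_at y s' F' ->
  (diff_span s' F' <= diff_span s F)%MS.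
Proof.
move=> h; rewrite submxE; apply/eqP/matrixP => i j; rewrite [RHS]mxE.
have mul_col (A B : 'M[R]_d) : A *m col j B = col j (A *m B).
  by apply/colP => k; rewrite !mxE; apply: eq_bigr => l _; rewrite mxE.
pose v := (col j (cokermx (diff_span s F)))^T.
have /h/kernel_at_diff_span : kernel_at y s F v.
  apply/kernel_at_diff_span; rewrite trmxK mul_col mulmx_coker.
  by apply/colP => k; rewrite !mxE.
by rewrite trmxK mul_col => /colP/(_ i); rewrite mxE => ->; rewrite mxE.
Qed.

Lemma rank_diff_span_full s G : #|G| = d -> \rank (diff_span s G) = d.
Proof.
move=> Gd; apply/eqP; rewrite eqn_leq rank_leq_col /=.
pose f (i : 'I_d) := enum_val (cast_ord (esym Gd) i).
have finj : injective f by move=> i j /enum_val_inj /cast_ord_inj.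
have := ygp.2 s f finj; rewrite /row_free => /eqP {1}<-.
apply: mxrankS; apply/row_subP => i; rewrite rowK.
by apply: (submx_trans _ (sumsmx_sup (f i) (enum_valP _) (submx_refl _))); rewrite genmxE.
Qed.

(** With at least [d] differences, some [d] of them already span the space. With
    fewer, they can be completed to [d] independent ones, and subadditivity of
    the rank leaves no room for a relation among them. *)
Lemma rank_diff_span s F : \rank (diff_span s F) = minn d #|F|.
Proof.
have le_card G : (\rank (diff_span s G) <= #|G|)%N.
  rewrite -sum1_card; apply: leq_trans (mxrank_sum_leqif _).1 _ => /=.
  by apply: leq_sum => k _; rewrite mxrank_gen rank_leq_row.
have [dF|Fd] := leqP d #|F|.
  have d0 : (#|@finset.set0 'I_n.-1| <= d)%N by rewrite cards0.
  have [G [_ GF Gd]] := exists_card_set (finset.sub0set F) d0 dF.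
  apply/eqP; rewrite eqn_leq rank_leq_col /= -{1}(rank_diff_span_full s Gd).
  by apply/mxrankS/sumsmx_subP => k /(fintype.subsetP GF) kF; apply: sumsmx_sup kF _.
have dn : (d <= #|[set: 'I_n.-1]%SET|)%N by rewrite cardsT card_ord; have := ygp.1; lia.
have [G [FG _ Gd]] := exists_card_set (finset.subsetT F) (ltnW Fd) dn.
apply/eqP; rewrite eqn_leq le_card /=.
have spanG : diff_span s G = (diff_span s F + diff_span s (G :\: F))%MS.
  by rewrite /diff_span (big_setID F) /= (finset.setIidPr FG).
have := mxrank_adds_leqif (diff_span s F) (diff_span s (G :\: F)).
rewrite -spanG (rank_diff_span_full s Gd) => -[+ _].
move=> /leq_trans/(_ (leq_add (leqnn _) (le_card _))).
rewrite cardsD (finset.setIidPr FG) Gd => h; move: Fd h; move: (\rank _) #|F| => a b; lia.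
Qed.

(** For nested flats, equality is equality of dimensions, and in general
    position the dimension of a flat can be read off its labels. *)
Lemma kernel_at_subP s F s' F' : kernel_at y s' F' `<=` kernel_at y s F ->
  kernel_at y s F `<=` kernel_at y s' F' <-> minn d #|F| = minn d #|F'|.
Proof.
move=> /kernel_at_sub F'F; rewrite -(rank_diff_span s F) -(rank_diff_span s' F').
split=> [/kernel_at_sub FF'|rFF'].
  by apply/eqP; rewrite eqn_leq !mxrankS.
have FF' : (diff_span s' F' <= diff_span s F)%MS.
  by rewrite -(geq_leqif (mxrank_leqif_sup F'F)) rFF'.
move=> v /kernel_at_diff_span/eqP; rewrite -sub_kermx => Fv.
by apply/kernel_at_diff_span/eqP; rewrite -sub_kermx (submx_trans FF').
Qed.

(** The weak inequalities defining a chamber have a nonzero solution only if the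
    strict ones have a solution. At a nonzero point fewer than [d] of the weak
    inequalities are tight, so general position provides a direction [u] along
    which all the tight ones become strict at once. *)
Lemma chamber_neq0 s v : v != 0 ->
  (forall k, dotv (consec_diff (y \o s) k) v <= 0) -> chamber (y \o s) !=set0.
Proof.
move=> v0 vle.
pose F := [set k | dotv (consec_diff (y \o s) k) v == 0]%SET.
have Fd : (#|F| < d)%N.
  rewrite ltnNge; apply/negP => dF; move/eqP: v0; apply.
  have /kernel_at_diff_span : kernel_at y s F v by move=> k; rewrite inE => /eqP.
  have : row_free (diff_span s F) by rewrite /row_free rank_diff_span (minn_idPl dF).
  rewrite row_free_unit => /mulKmx Fu /(congr1 (mulmx (invmx (diff_span s F)))).
  by rewrite Fu mulmx0 => /(congr1 trmx); rewrite trmxK trmx0.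
have dn : (d <= #|[set: 'I_n.-1]%SET|)%N by rewrite cardsT card_ord; have := ygp.1; lia.
have [G [FG _ Gd]] := exists_card_set (finset.subsetT F) (ltnW Fd) dn.
pose f (i : 'I_d) := enum_val (cast_ord (esym Gd) i).
have finj : injective f by move=> i j /enum_val_inj /cast_ord_inj.
have := ygp.2 s f finj; set M := (X in row_free X); rewrite row_free_unit => Mu.
pose u : 'rV[R]_d := (invmx M *m const_mx (-1))^T.
have uF k : k \in F -> dotv (consec_diff (y \o s) k) u = -1.
  move=> /(fintype.subsetP FG) kG.
  pose i := cast_ord Gd (enum_rank_in kG k).
  have fi : f i = k by rewrite /f /i cast_ordK enum_rankK_in.
  have Mi : (M *m u^T) i 0 = -1 by rewrite trmxK mulKVmx// mxE.
  by rewrite -fi /dotv -(rowK (fun i => consec_diff (y \o s) (f i))) -row_mul [LHS]mxE.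
pose bs := [seq - consec_diff (y \o s) k | k <- enum (~: F)].
have vbs : cuts bs v.
  move=> _ /mapP[k + ->]; rewrite mem_enum !inE dotvNl oppr_gt0 => kF.
  by rewrite lt_neqAle kF vle.
have [e e0 [vu _]] := cuts_open u vbs.
exists (v + e *: u) => k; have [kF|kF] := boolP (k \in F).
  rewrite dotvDr dotvZr (uF _ kF) mulrN1.
  by move: kF; rewrite inE => /eqP->; rewrite add0r oppr_lt0.
rewrite -oppr_gt0 -dotvNl; apply: vu; apply/mapP; exists k => //.
by rewrite mem_enum inE.
Qed.

End GeneralPosition.

(** The inclusions that govern the number of cells are read off from the sizes
    of sets of consecutive pairs, and these sets are chosen by the labels alone,
    hence in common for [y] and [z]. *)
Lemma card_chambers_general_position d (y z : 'I_n -> 'rV[R]_d) :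
  general_position_A y -> general_position_A z ->
  #|[pred s : 'S_n | `[< chamber (y \o s) !=set0 >]]| =
  #|[pred s : 'S_n | `[< chamber (z \o s) !=set0 >]]|.
Proof.
move=> ygp zgp; rewrite !card_chambers.
have levelT (x : 'I_n -> 'rV[R]_d) : setT = level_space x id.
  by apply/seteqP; split=> // v _ i j ->.
rewrite [in LHS](levelT y) [in RHS](levelT z); apply: ncells_level_space => c p q.
have [s [F cF]] := level_space_sorted c.
have [s' [F' cF']] := level_space_sorted (merge c p q).
have orthE (x : 'I_n -> 'rV[R]_d) : general_position_A x ->
    level_space x c `<=` orth (x p - x q) <-> minn d #|F| = minn d #|F'|.
  move=> xgp; rewrite -(@kernel_at_subP _ _ xgp s F s' F') -cF -cF' level_space_merge.
    by split=> [h v xv|h v /h[]//]; split=> //; exact: h.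
  by move=> v [].
by rewrite !orthE.
Qed.

End Chambers.

(** * Measurability of random cones *)

Section DirectionBoxes.
Context {R : realType} {d : nat}.
Local Notation V := 'rV[R]_d.
Implicit Types (u v : V) (C D : set V).

Lemma enorm_ge0 u : 0 <= enorm u.
Proof. exact: sqrtr_ge0. Qed.

Lemma enormE u : enorm u ^+ 2 = dotv u u.
Proof. by rewrite sqr_sqrtr// dotvv_ge0. Qed.

Lemma enormZ a u : 0 <= a -> enorm (a *: u) = a * enorm u.
Proof.
move=> a0; rewrite /enorm dotvZl dotvZr mulrA -expr2 sqrtrM ?sqr_ge0//.
by rewrite sqrtr_sqr ger0_norm.
Qed.

Lemma enorm_gt0 u : u != 0 -> 0 < enorm u.
Proof. by move=> u0; rewrite sqrtr_gt0 dotvv_gt0. Qed.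

Lemma coord_le_enorm u j : `|u 0 j| <= enorm u.
Proof.
rewrite -(@ler_pXn2r _ 2)// ?nnegrE ?enorm_ge0// enormE dotvE.
rewrite (bigD1 j)//= real_normK ?num_real// expr2 lerDl sumr_ge0// => i _.
by rewrite -expr2 sqr_ge0.
Qed.

Lemma enorm_le e u : 0 <= e -> (forall j, `|u 0 j| <= e) -> enorm u <= d%:R * e.
Proof.
move=> e0 ue; rewrite -(@ler_pXn2r _ 2)// ?nnegrE ?enorm_ge0 ?mulr_ge0//.
rewrite enormE dotvE exprMn.
apply: (@le_trans _ _ (\sum_(j < d) e ^+ 2)).
  by apply: ler_sum => j _; rewrite -expr2 -real_normK ?num_real// ler_pXn2r// nnegrE.
rewrite sumr_const card_ord -[leLHS]mulr_natl ler_wpM2r ?sqr_ge0//.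
by rewrite -natrX ler_nat; case: (d) => // k; rewrite -{1}(expn1 k.+1) leq_pexp2l.
Qed.

Definition grid m := {ffun 'I_d -> 'I_(m.+1.*2.+1)}.

(** The vectors whose direction [v / enorm v] has each coordinate closer than
    [1 / m.+1] to that of a grid point; the grid covers the cube [[-1, 1]^d]
    with mesh [1 / m.+1]. Multiplying out the norm keeps the condition
    continuous in [v]. *)
Definition dir_box m (z : grid m) : set V :=
  [set v | 0 < enorm v /\ forall j,
     `|m.+1%:R * (v 0 j + enorm v) - (z j)%:R * enorm v| < enorm v].

Lemma dir_box_cover m u : enorm u = 1 -> exists z : grid m, dir_box z u.
Proof.
move=> u1.
pose t j : R := m.+1%:R * (u 0 j + 1).
have uj j : -1 <= u 0 j <= 1 by rewrite -ler_norml -u1 coord_le_enorm.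
have t0 j : 0 <= t j by rewrite mulr_ge0//; have := uj j; lra.
have tm j : (Num.truncn (t j) < m.+1.*2.+1)%N.
  rewrite truncn_lt_nat// -addn1 natrD -muln2 natrM /t.
  rewrite (@le_lt_trans _ _ (m.+1%:R * 2))// ?ltrDl//.
  by rewrite ler_wpM2l//; have := uj j; lra.
exists [ffun j => Ordinal (tm j)]; split=> [|j]; rewrite u1 ?ltr01//.
rewrite ffunE /= mulr1 -/(t j).
have /andP[] := truncn_itv (t0 j); rewrite -natr1 ltr_norml => a b.
by apply/andP; split; lra.
Qed.

Lemma dir_box_dist m (z : grid m) u v : dir_box z u -> dir_box z v ->
  enorm u = 1 -> enorm v = 1 -> enorm (u - v) <= d%:R * (2 / m.+1%:R).
Proof.
move=> [_ uz] [_ vz] u1 v1; apply: enorm_le => [|j]; first by rewrite divr_ge0.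
rewrite ler_pdivlMr// mulrC -[X in X * _]gtr0_norm// -normrM !mxE.
have := uz j; have := vz j; rewrite u1 v1 !mulr1.
rewrite !ltr_norml ler_norml => /andP[a b] /andP[a' b'].
by apply/andP; split; lra.
Qed.

Lemma dir_boxZ m (z : grid m) a v : 0 < a -> dir_box z v -> dir_box z (a *: v).
Proof.
move=> a0 [v0 vz]; split=> [|j]; rewrite (enormZ _ (ltW a0)) ?mulr_gt0//.
have := vz j; rewrite -(ltr_pM2l a0) -[X in X * `|_|](gtr0_norm a0) -normrM.
rewrite mxE; congr (`|_| < _); ring.
Qed.

Definition hits m (C : set V) : set (grid m) :=
  [set z | C `&` dir_box z !=set0].

Lemma hits_cone_close m C D : polyhedral_cone C -> polyhedral_cone D ->
  hits (m := m) C = hits D -> cone_close (d%:R * (2 / m.+1%:R)) C D.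
Proof.
have half A B : polyhedral_cone B -> hits (m := m) A `<=` hits B ->
    forall u, A u -> enorm u = 1 -> exists v,
      [/\ B v, enorm v = 1 & enorm (u - v) <= d%:R * (2 / m.+1%:R)].
  move=> [s Bs] AB u Au u1; have [z uz] := dir_box_cover m u1.
  have /AB[v [Bv vz]] : hits A z by exists u.
  have v0 : 0 < enorm v by case: vz.
  have v1 : enorm ((enorm v)^-1 *: v) = 1.
    by rewrite enormZ ?mulVf ?gt_eqF// invr_ge0 ltW.
  exists ((enorm v)^-1 *: v); split=> //.
    move: Bv; rewrite Bs => Bv a /Bv av.
    by rewrite dotvZl mulr_ge0_le0// invr_ge0 ltW.
  by apply: (dir_box_dist uz) => //; apply: dir_boxZ => //; rewrite invr_gt0.
move=> pC pD CD; split; first by apply: half => //; rewrite CD.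
move=> v Dv v1; have [|u [Cu u1 vu]] := half D C pC _ v Dv v1; first by rewrite CD.
by exists u; split=> //; rewrite -opprB /enorm dotvNl dotvNr opprK.
Qed.

(** The whole space is an isolated cone: the unit vectors of a proper polyhedral
    cone are at distance at least [sqrt 2] from the outer unit normal of any
    half-space containing it. *)
Lemma cone_open_proper : cone_open [set C : set V | polyhedral_cone C /\ C <> setT].
Proof.
split=> [C []//|C [pC CT]].
have [a a0 Ca] := polyhedral_neqT pC CT.
exists 1 => // D pD [_ DC]; split=> // DT.
have a1 : enorm ((enorm a)^-1 *: a) = 1.
  by rewrite enormZ ?invr_ge0 ?enorm_ge0// mulVf// gt_eqF// enorm_gt0.
have Da : D ((enorm a)^-1 *: a) by rewrite DT.
have [u [Cu u1]] := DC _ Da a1.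
set b := _ *: a in a1 *.
have ub : dotv u b <= 0.
  by rewrite dotvZr mulr_ge0_le0// ?invr_ge0 ?enorm_ge0//; exact: Ca.
rewrite leNgt => /negP; apply.
rewrite -(@ltr_pXn2r _ 2)// ?nnegrE ?enorm_ge0// enormE dotvBl !dotvBr.
rewrite -!enormE u1 a1 (dotvC b u) !expr1n.
by lra.
Qed.

End DirectionBoxes.

Section RandomHulls.
Context {R : realType} {d : nat}.
Local Notation V := 'rV[R]_d.

(** A random cone is measurable as soon as the events that it meets a given
    direction box are. At each scale there are finitely many boxes, and cones
    meeting the same boxes are close; so an open set of cones is the union,
    over the scales and the finite sets of boxes, of those classes of cones
    meeting the same boxes that it contains. *)
Lemma measurable_random_cone (disp : measure_display) (T : measurableType disp)
    (X : T -> set V) :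
  (forall w, polyhedral_cone (X w)) ->
  (forall m (z : grid m), measurable [set w | hits (X w) z]) ->
  forall B, cone_borel B -> measurable [set w | B (X w)].
Proof.
move=> pX mX; apply: smallest_sub.
  split=> [|A mA|A mA].
  - by rewrite [X in measurable X](_ : _ = set0)//.
  - rewrite [X in measurable X](_ : _ = ~` [set w | A (X w)]).
      exact: measurableC.
    by apply/seteqP; split=> [w []//|w ?]; split.
  - rewrite [X in measurable X](_ : _ = \bigcup_k [set w | A k (X w)]).
      exact: bigcup_measurable.
    by apply/seteqP; split=> w [k _ Ak]; exists k.
move=> U [Up Uo].
pose meets m (I : {set grid m}) w := forall z, z \in I <-> hits (X w) z.
pose good m (I : {set grid m}) := forall C, polyhedral_cone C ->
  (forall z, z \in I <-> hits C z) -> U C.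
rewrite [X in measurable X](_ : _ =
    \bigcup_m \bigcup_(I in good m) [set w | meets m I w]); last first.
  apply/seteqP; split=> w; last first.
    by move=> [m _ [I gI IX]]; exact: gI.
  move=> UX; have [e e0 eU] := Uo _ UX.
  (* the scale at which the bound of [hits_cone_close] drops below [e] *)
  pose m := Num.truncn (d%:R * 2 / e : R).
  exists m => //; pose I := [set z : grid m | `[< hits (X w) z >]]%SET.
  have IX : meets m I w by move=> z; rewrite inE; split=> /asboolP.
  exists I => // C pC IC; apply: eU => //.
  have hE : hits (m := m) (X w) = hits C.
    by apply/seteqP; split=> z; [move=> /IX/IC|move=> /IC/IX].
  have [XC CX] := hits_cone_close (pX w) pC hE.
  have me : d%:R * (2 / m.+1%:R) <= e.
    rewrite mulrA ler_pdivrMr// [leRHS]mulrC -ler_pdivrMr// ltW//.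
    have x0 : 0 <= d%:R * 2 / e by rewrite divr_ge0// ltW.
    by have /andP[] := truncn_itv x0.
  split=> u uX u1.
    by have [v [? ? uv]] := XC u uX u1; exists v; split=> //; exact: le_trans me.
  by have [v [? ? uv]] := CX u uX u1; exists v; split=> //; exact: le_trans me.
apply: bigcup_measurable => m _.
apply: fin_bigcup_measurable => [|I _]; first exact: finite_finset.
rewrite [X in measurable X](_ : _ = \bigcap_(z in [set: grid m])
    (if z \in I then [set w | hits (X w) z] else ~` [set w | hits (X w) z])).
  apply: fin_bigcap_measurable => [|z _]; first exact: finite_finset.
  by case: ifP => _; [|apply: measurableC]; exact: mX.
apply/seteqP; split=> w IX z; last first.
  by have := IX z Logic.I; case: ifP => // zI; split.
by move=> _; have := IX z; case: ifP => zI [h1 h2]; [exact: h1|move=> /h2].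
Qed.

Lemma enorm_continuous : continuous (@enorm R d).
Proof.
move=> v; apply: (@continuous_comp _ _ _ (fun v : V => dotv v v) Num.sqrt).
  have -> : (fun v : V => dotv v v) = fun v => \sum_j v 0 j * v 0 j.
    by apply/funext => u; rewrite dotvE.
  apply: (@continuous_big R^o _ +%R 0 xpredT) => [|j _ u].
    exact: add_continuous.
  by apply: (@cvgM _ _ (nbhs u) _ (fun v : V => v 0 j) (fun v : V => v 0 j));
    exact: coord_continuous.
exact: sqrt_continuous.
Qed.

Lemma open_dir_box m (z : grid m) : open (dir_box z : set V).
Proof.
rewrite openE => v [v0 vz].
near=> u; split; first by near: u; apply: (cvgr_gt (enorm v)) => //; exact: enorm_continuous.
near: u; apply: filter_forall => j.
pose h (u : V) := `|m.+1%:R * (u 0 j + enorm u) - (z j)%:R * enorm u| - enorm u.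
have hv : h u @[u --> v] --> h v.
  have ev : enorm u @[u --> v] --> enorm v by exact: enorm_continuous.
  have jv : (fun u : V => u 0 j) @ v --> v 0 j by exact: coord_continuous.
  apply: (cvgB _ ev); apply: cvg_norm.
  by apply: cvgB; apply: cvgMl_tmp => //; exact: (cvgD jv ev).
have : h v < 0 by rewrite subr_lt0; exact: vz.
move=> /(cvgr_lt _ hv); apply: filterS => u.
by rewrite /h subr_lt0.
Unshelve. all: by end_near. Qed.

(** Rational coefficients being dense, meeting an open set is a countable
    condition on the generators. The absolute values let the coefficients range
    over all rationals. *)
Lemma pos_hull_meets_open k (x : 'I_k -> V) (G : set V) : open G ->
  pos_hull x `&` G !=set0 <->
  exists q : {ffun 'I_k -> rat}, G (\sum_i `|ratr (q i)| *: x i).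
Proof.
move=> oG; split=> [|[q Gq]]; last first.
  by exists (\sum_i `|ratr (q i)| *: x i); split=> //; exists (fun i => `|ratr (q i)|).
move=> [_ [[c c0 ->] Gc]].
pose L (a : 'rV[R]_k) : V := \sum_i a 0 i *: x i.
have Lcont : continuous L.
  apply: (@continuous_big V _ +%R 0 xpredT) => [|i _ a]; first exact: add_continuous.
  have ai : (fun a : 'rV[R]_k => a 0 i) @ a --> a 0 i by exact: coord_continuous.
  exact: (cvgZr_tmp ai).
have : nbhs (\row_i c i) (L @^-1` G).
  apply: Lcont; apply: open_nbhs_nbhs; split=> //.
  by rewrite /L; under eq_bigr do rewrite mxE.
move=> /nbhs_ballP[e /= e0 eG].
have qP i : exists q : rat, ratr q \in `]c i, c i + e[.
  by apply: rat_in_itvoo; rewrite ltrDl.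
pose q i := xchoose (qP i).
exists [ffun i => q i].
have : (L @^-1` G) (\row_i `|ratr (q i)|).
  apply: eG; split=> // j i; rewrite !mxE.
  have := xchooseP (qP i); rewrite -/(q i) in_itv /= => /andP[h1 h2].
  rewrite /ball /= (ger0_norm (ltW (le_lt_trans (c0 i) h1))).
  by rewrite distrC ger0_norm ?subr_ge0 ?ltW// ltrBlDl.
rewrite /L /preimage /=; congr G; apply: eq_bigr => i _; by rewrite mxE ffunE.
Qed.

End RandomHulls.

Section HullOfTuple.
Context {R : realType} {d : nat}.
Local Notation V := 'rV[R]_d.

Lemma measurable_coord (j : 'I_d) :
  measurable_fun [set: borel_rV R d] (fun v : borel_rV R d => (v : V) 0 j).
Proof.
apply: (measurability _ (RGenOpens.measurableE R)).
move=> _ [_ [a [b ->]] <-]; rewrite setTI.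
apply: sub_sigma_algebra; apply: open_comp; last exact: itv_open.
by move=> v _; exact: coord_continuous.
Qed.

Lemma measurable_dir_box (disp : measure_display) (T : measurableType disp)
    (f : T -> V) m (z : grid m) :
  (forall j, measurable_fun setT (fun w => f w 0 j)) ->
  measurable [set w | dir_box z (f w)].
Proof.
move=> mf.
have mnorm : measurable_fun setT (fun w => enorm (f w)).
  rewrite (_ : (fun w => _) = Num.sqrt \o (fun w => \sum_j f w 0 j * f w 0 j)); last first.
    by apply/funext => w /=; rewrite -dotvE.
  apply: measurableT_comp; first exact: (continuous_measurable_fun (@sqrt_continuous R)).
  by apply: measurable_sum => j; exact: measurable_funM.
have mlt (g h : T -> R) : measurable_fun setT g -> measurable_fun setT h ->
    measurable [set w | g w < h w].
  move=> mg mh; have := measurable_fun_ltr mg mh measurableT (Y := [set true]) Logic.I.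
  by rewrite setTI.
rewrite (_ : [set w | _] = [set w | 0 < enorm (f w)] `&`
   \bigcap_(j in [set: 'I_d])
     [set w | `|m.+1%:R * (f w 0 j + enorm (f w)) - (z j)%:R * enorm (f w)|
              < enorm (f w)]).
  apply: measurableI; first exact: mlt.
  apply: fin_bigcap_measurable => [|j _]; first exact: finite_finset.
  apply: mlt => //; apply: measurableT_comp; first exact: normr_measurable.
  apply: measurable_funB; last exact: measurable_funM.
  by apply: measurable_funM => //; exact: measurable_funD.
apply/seteqP; split=> w [w0 h]; split=> // j; first by move=> _; exact: h.
exact: h.
Qed.

Lemma measurable_hull n (B : set (set V)) : cone_borel B ->
  measurable [set t : n.-tuple (borel_rV R d) |
    B (pos_hull (consec_diff (tnth t : 'I_n -> V)))].
Proof.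
apply: measurable_random_cone => [t|m z]; first exact: polyhedral_pos_hull.
rewrite (_ : [set t | _] = \bigcup_(q : {ffun 'I_n.-1 -> rat})
    [set t : n.-tuple (borel_rV R d) | dir_box z
      (\sum_i `|ratr (q i)| *: consec_diff (tnth t : 'I_n -> V) i)]); last first.
  apply/seteqP; split=> t.
    by move=> /(pos_hull_meets_open _ (@open_dir_box _ _ _ z))[q qz]; exists q.
  by move=> [q _ qz]; apply/(pos_hull_meets_open _ (@open_dir_box _ _ _ z)); exists q.
apply: countable_bigcupT_measurable => [|q]; first exact: countableP.
apply: measurable_dir_box => j.
under eq_fun do rewrite summxE.
apply: measurable_sum => i; under eq_fun do rewrite !mxE.
have mj (a : 'I_n) :
    measurable_fun setT (fun t : n.-tuple (borel_rV R d) => (tnth t a : V) 0 j).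
  apply: (@measurableT_comp _ _ _ _ _ _ (fun v : borel_rV R d => (v : V) 0 j)).
    exact: measurable_coord.
  exact: measurable_tnth.
by apply: measurable_funM => //; exact: measurable_funB.
Qed.

End HullOfTuple.

(** * The Weyl tessellation *)

Section Tessellation.
Context {R : realType} {d n : nat}.
Local Notation V := 'rV[R]_d.
Implicit Types (y : 'I_n -> V) (s t : 'S_n).

Lemma weyl_complementP y v :
  (~` weyl_hyperplanes_A y) v <->
  forall i j, i != j -> dotv (y i) v != dotv (y j) v.
Proof.
split=> [vy i j|vy [[i j] /= ij]]; last first.
  rewrite /orth /= dotvC dotvBl => /eqP; rewrite subr_eq0; apply/negP/vy.
  by rewrite -val_eqE ltn_eqF.
have lt_neq (a b : 'I_n) : (a < b)%N -> dotv (y a) v != dotv (y b) v.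
  move=> ab; apply/eqP => vab; apply: vy; exists (a, b) => //.
  by rewrite /orth /= dotvC dotvBl vab subrr.
by rewrite -val_eqE neq_ltn => /orP[/lt_neq//|/lt_neq]; rewrite eq_sym.
Qed.

Lemma chamber_sub_complement y s : chamber (y \o s) `<=` ~` weyl_hyperplanes_A y.
Proof. by move=> v sv; apply/weyl_complementP => i j; exact: dotv_perm_neq. Qed.

Lemma chamber_segment y u v (t : R) : chamber y u -> chamber y v ->
  0 <= t <= 1 -> chamber y (u + t *: (v - u)).
Proof.
move=> yu yv /andP[t0 t1] k; rewrite dotvDr dotvZr dotvBr.
by have := yu k; have := yv k; move: (dotv _ u) (dotv _ v) => a b; nra.
Qed.

(** A chamber is reached from any of its points along segments, and the
    functions [dotv (y i - y j)] keep a constant sign on connected sets avoiding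
    the hyperplanes. *)
Lemma component_chamber y s v : chamber (y \o s) v ->
  connected_component (~` weyl_hyperplanes_A y) v = chamber (y \o s).
Proof.
move=> sv; have Av := chamber_sub_complement sv.
apply/seteqP; split=> u; last first.
  move=> su; pose f (t : R) : V := v + t *: (u - v).
  have fc : continuous f.
    move=> r; apply: cvgD; first exact: cvg_cst.
    by apply: cvgZr_tmp; exact: cvg_id.
  apply: (@connected_component_max _ _ (f @` `[0, 1]%classic)).
  - by exists 0; rewrite /f ?scale0r ?addr0//= in_itv /= lexx ler01.
  - move=> _ [r /= r01 <-].
    by apply/chamber_sub_complement/chamber_segment => //; rewrite in_itv in r01.
  - apply: connected_continuous_connected; last exact: continuous_subspaceT.
    exact/connected_intervalP/interval_is_interval.
  - by exists 1; rewrite /f ?scale1r ?subrKC//= in_itv /= lexx ler01.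
set K := connected_component _ _ => Ku; apply/chamberP => a b ab.
rewrite -subr_lt0 -dotvBl ltNge; apply/negP => u0.
pose f := @dotv R d ((y \o s) a - (y \o s) b).
have fK : connected (f @` K).
  apply: connected_continuous_connected; first exact: component_connected.
  by apply: continuous_subspaceT => x; exact: dotv_continuous.
have fv : (f @` K) (f v) by exists v => //; exact: connected_component_refl.
have fu : (f @` K) (f u) by exists u.
have v0 : f v < 0 by rewrite /f dotvBl subr_lt0; exact: (chamberP _ _).1.
move/connected_intervalP: fK => /(_ _ _ fv fu 0); rewrite (ltW v0) => /(_ u0)[w Kw].
rewrite /f dotvBl => /eqP; rewrite subr_eq0; apply/negP.
move/connected_component_sub: Kw => /weyl_complementP; apply.
by rewrite (inj_eq perm_inj) -val_eqE ltn_eqF.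
Qed.

(** A point of the closed cone is the limit of points of the chamber along the
    direction of any given point of the chamber. *)
Lemma closure_chamber y : chamber y !=set0 ->
  closure (chamber y) = dual_cone (pos_hull (consec_diff y)).
Proof.
move=> [u yu]; rewrite dual_pos_hull; apply/seteqP; split=> v.
  have cl : closed [set v : V | forall k, dotv (consec_diff y k) v <= 0].
    rewrite (_ : [set v | _] = \bigcap_(k in [set: 'I_n.-1])
        (dotv (consec_diff y k) @^-1` [set r | r <= 0])).
      apply: closed_bigI => k _; apply: closed_comp; last exact: closed_le.
      by move=> x _; exact: dotv_continuous.
    by apply/seteqP; split=> w h k; [move=> _|]; exact: h.
  move=> yv; have -> := (closure_id _).1 cl; apply: closureS yv => w yw k.
  exact/ltW/yw.
move=> vy B vB.
have : (fun t : R => v + t *: u) @ 0^'+ --> v.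
  apply: cvg_at_right_filter; rewrite -[X in _ --> X](addr0 v) -(scale0r u).
  apply: cvgD; first exact: cvg_cst.
  by apply: cvgZr_tmp; exact: cvg_id.
move=> /(_ _ vB) tB.
have {}tB : \forall t \near (0 : R)^'+, B (v + t *: u) by exact: tB.
have t0 : \forall t \near (0 : R)^'+, 0 < t by exact: nbhs_right_gt.
have [t [tB' t0']] := filter_ex (filterI tB t0).
exists (v + t *: u); split=> // k.
have vk : dotv (consec_diff y k) v <= 0 := vy k.
have uk : t * dotv (consec_diff y k) u < 0 by rewrite pmulr_rlt0//; exact: yu.
by rewrite dotvDr dotvZr; lra.
Qed.

Lemma weyl_tessellationE y : weyl_tessellation_A y =
  [set dual_cone (pos_hull (consec_diff (y \o s)))
     | s in [set s : 'S_n | chamber (y \o s) !=set0]].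
Proof.
apply/seteqP; split=> [_ [v Av <-]|_ [s [v sv] <-]].
  have [s sv] := exists_chamber ((weyl_complementP _ _).1 Av).
  exists s; first by exists v.
  by rewrite (component_chamber sv) closure_chamber//; exists v.
exists v; first exact: chamber_sub_complement.
by rewrite (component_chamber sv) closure_chamber//; exists v.
Qed.

(** A point of the chamber of [s] lies on no hyperplane, so it is interior to
    each closed chamber containing it. *)
Lemma dual_hull_inj y :
  set_inj [set s : 'S_n | chamber (y \o s) !=set0]
    (fun s : 'S_n => dual_cone (pos_hull (consec_diff (y \o s)))).
Proof.
move=> s t; rewrite !inE /= => -[u su] _; rewrite !dual_pos_hull => st.
have tu : chamber (y \o t) u.
  have : [set v | forall k, dotv (consec_diff (y \o t) k) v <= 0] u.
    by rewrite -st => k; exact/ltW/su.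
  move=> ut k; rewrite lt_neqAle ut andbT dotvBl subr_eq0.
  apply: (dotv_perm_neq su); rewrite (inj_eq perm_inj) -val_eqE /=.
  by rewrite ltn_eqF.
exact: (chamber_perm_inj su tu).
Qed.

Lemma finite_weyl_tessellation y : finite_set (weyl_tessellation_A y).
Proof. by rewrite weyl_tessellationE; apply: finite_image; exact: finite_finset. Qed.

Lemma big_weyl_tessellation (S : Type) (idx : S) (op : Monoid.com_law idx) y
    (f : set V -> S) :
  \big[op/idx]_(C \in weyl_tessellation_A y) f C =
  \big[op/idx]_(s : 'S_n | `[< chamber (y \o s) !=set0 >])
     f (dual_cone (pos_hull (consec_diff (y \o s)))).
Proof.
rewrite weyl_tessellationE fsbig_image; last exact: dual_hull_inj.
rewrite [RHS]bigfs ?index_enum_uniq//; last by move=> s _; rewrite mem_index_enum.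
congr (\big[op/idx]_(s \in _) _); apply/seteqP; split=> s /asboolP //.
Qed.

Lemma card_weyl_tessellation y :
  #|` fset_set (weyl_tessellation_A y)| =
  #|[pred s : 'S_n | `[< chamber (y \o s) !=set0 >]]|.
Proof.
rewrite -sum1_size -fsbig_finite; last exact: finite_weyl_tessellation.
by rewrite big_weyl_tessellation sum1_card.
Qed.

(** The event on which the dual cone is conditioned is the event that a given
    order is realized: a proper hull has a nonzero vector in its dual by
    Farkas' lemma, and then its dual has interior points by general position. *)
Lemma pos_hull_neqTE y s : (2 <= n)%N -> general_position_A y ->
  pos_hull (consec_diff (y \o s)) <> setT <-> chamber (y \o s) !=set0.
Proof.
move=> n2 ygp; split=> [hT|[v sv] hT].
  have [v v0] := polyhedral_neqT (polyhedral_pos_hull _) hT.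
  by rewrite dual_pos_hull; exact: chamber_neq0.
have : dual_cone (pos_hull (consec_diff (y \o s))) v.
  by rewrite dual_pos_hull => k; exact/ltW/sv.
rewrite hT => /(_ v Logic.I) v0.
have n1 : (0 < n.-1)%N by rewrite -subn1 subn_gt0.
have := sv (Ordinal n1); rewrite (_ : v = 0) ?dotv0 ?ltxx//.
by apply/eqP; rewrite -dotvv_eq0 eq_le v0 dotvv_ge0.
Qed.

End Tessellation.

(** * Distributions *)

Section NullSets.
Import HBNNSimple.

(** The integral of a nonnegative function is a supremum over the simple
    functions below it, so it does not see null sets even when the function is
    not measurable. *)
Lemma le_integral_ae (disp : measure_display) (T : measurableType disp)
    (R : realType) (mu : {measure set T -> \bar R}) (f g : T -> \bar R) :
  (forall x, (0 <= f x)%E) -> (forall x, (0 <= g x)%E) ->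
  {ae mu, forall x, (f x <= g x)%E} ->
  (\int[mu]_x f x <= \int[mu]_x g x)%E.
Proof.
move=> f0 g0 [N [mN N0 fgN]].
rewrite !ge0_integralTE//; apply: ge_ereal_sup => _ [h hf <-].
have mN' := measurableC mN; pose k := proj_nnsfun h mN'.
have kE x : k x = if x \in N then 0 else h x.
  rewrite /k /= mindicE in_setC; case: (x \in N) => /=; first by rewrite mulr0.
  by rewrite mulr1.
have -> : sintegral mu h = sintegral mu k.
  rewrite -!integralT_nnsfun.
  rewrite (ge0_negligible_integral mN measurableT _ _ N0)//; last 2 first.
  - exact/measurable_EFinP.
  - by move=> x _; rewrite lee_fin fun_ge0.
  rewrite [RHS](ge0_negligible_integral mN measurableT _ _ N0)//; last 2 first.
  - exact/measurable_EFinP.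
  - by move=> x _; rewrite lee_fin fun_ge0.
  apply: eq_integral => x; rewrite in_setD => /andP[_ xN].
  by congr EFin; apply/esym/(etrans (kE x)); rewrite (negbTE xN).
apply: ereal_sup_ubound; exists k => // x.
have -> : k x = if x \in N then 0 else h x := kE x.
have [xN|xN] := boolP (x \in N); first exact: g0.
apply: le_trans (hf x) _; apply: contrapT => nfg; move/negP: xN; apply.
by rewrite inE; exact: fgN.
Qed.

End NullSets.

Section WeylCones.
Context {disp : measure_display} {T : measurableType disp} {R : realType}.
Context (P : probability T R) {d n : nat} (Y : 'I_n -> {RV P >-> borel_rV R d}).
Implicit Types (B : set (set 'rV[R]_d)) (s : 'S_n).

Definition hull s w : set 'rV[R]_d := pos_hull (consec_diff (sample Y w \o s)).

Definition proper_hull_in B s : set T := [set w | B (hull s w) /\ hull s w <> setT].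

(** [proper_hull_in B 1] as an event about the tuple of vectors, the form to
    which exchangeability applies. *)
Definition proper_tuple B : set (n.-tuple (borel_rV R d)) :=
  [set t | let C := pos_hull (consec_diff (tnth t : 'I_n -> 'rV[R]_d)) in
           B C /\ C <> setT].

Lemma measurable_proper_tuple B : cone_borel B -> measurable (proper_tuple B).
Proof.
move=> hB; have hT : cone_borel [set C : set 'rV[R]_d | polyhedral_cone C /\ C <> setT].
  by apply: sub_sigma_algebra; exact: cone_open_proper.
rewrite (_ : proper_tuple B = [set t | B (pos_hull (consec_diff (tnth t : 'I_n -> 'rV[R]_d)))] `&`
  [set t | [set C : set 'rV[R]_d | polyhedral_cone C /\ C <> setT]
     (pos_hull (consec_diff (tnth t : 'I_n -> 'rV[R]_d)))]).
  by apply: measurableI; exact: measurable_hull.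
apply/seteqP; split=> t [Bt Ct]; last by split=> //; case: Ct.
by split=> //; split=> //; exact: polyhedral_pos_hull.
Qed.

Lemma proper_hull_inE B s :
  proper_hull_in B s = [set w | proper_tuple B [tuple Y (s i) w | i < n]].
Proof.
apply/funext => w; rewrite /proper_hull_in /proper_tuple /hull /=.
suff -> : (tnth [tuple Y (s i) w | i < n] : 'I_n -> 'rV[R]_d) = sample Y w \o s by [].
by apply/funext => i; rewrite tnth_mktuple.
Qed.

Lemma measurable_proper_hull_in B s : cone_borel B -> measurable (proper_hull_in B s).
Proof.
move=> hB; rewrite proper_hull_inE -[X in measurable X]setTI.
have : measurable_fun setT (fun w => [tuple Y (s i) w | i < n] : n.-tuple (borel_rV R d)).
  apply/measurable_fun_tnthP => i; rewrite (_ : _ \o _ = Y (s i)).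
    exact: measurable_funPT.
  by apply/funext => w /=; rewrite tnth_mktuple.
by apply => //; exact: measurable_proper_tuple.
Qed.

Hypothesis Yexch : exchangeable Y.

Lemma proper_hull_in_perm B s : cone_borel B ->
  P (proper_hull_in B s) = P (proper_hull_in B 1%g).
Proof.
move=> hB; have mB := measurable_proper_tuple hB.
by rewrite !proper_hull_inE -!Yexch.
Qed.

(** By exchangeability the [n`!] orders contribute equally. *)
Lemma integral_sum_proper_hull B : cone_borel B ->
  (\int[P]_w (\sum_(s : 'S_n) \1_(proper_hull_in B s) w)%:E =
   n`!%:R%:E * P (proper_hull_in B 1%g))%E.
Proof.
move=> hB; under eq_integral do rewrite -sumEFin.
rewrite ge0_integral_sum//; last first.
  move=> s; apply/measurable_EFinP; apply: measurable_indic.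
  exact: measurable_proper_hull_in.
transitivity (\sum_(s : 'S_n) P (proper_hull_in B 1%g))%E.
  apply: eq_bigr => s _; rewrite integral_indic//; last exact: measurable_proper_hull_in.
  by rewrite setIT; exact: proper_hull_in_perm.
by rewrite mule_natl sumr_const card_Sn.
Qed.

Hypothesis n2 : (2 <= n)%N.

(** The cones of the tessellation are the duals of the proper hulls among those
    obtained by permuting the points, so polarity turns a sum over the
    tessellation into a sum over the orders. *)
Lemma sum_weyl_tessellation_dual B w : general_position_A (sample Y w) ->
  \sum_(C \in weyl_tessellation_A (sample Y w))
     (\1_(polyhedral_cone `&` dual_cone @^-1` B) C : R) =
  \sum_(s : 'S_n) (\1_(proper_hull_in B s) w : R).
Proof.
move=> wgp; rewrite big_weyl_tessellation big_mkcond; apply: eq_bigr => s _.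
have hT := pos_hull_neqTE s n2 wgp.
case: asboolP => [/hT hs|hs].
  rewrite !indicE; congr (_%:R); congr nat_of_bool; apply/idP/idP; rewrite !inE.
    by move=> [_]; rewrite /preimage /= dual_dual_pos_hull.
  move=> [Bs _]; split; first exact: polyhedral_dual_pos_hull.
  by rewrite /preimage /= dual_dual_pos_hull.
by rewrite indicE memNset// => -[_ /hT].
Qed.

Hypothesis Ygp : {ae P, forall w, general_position_A (sample Y w)}.

Lemma integral_ae_eq (f g : T -> R) :
  (forall w, 0 <= f w) -> (forall w, 0 <= g w) ->
  (forall w, general_position_A (sample Y w) -> f w = g w) ->
  (\int[P]_w (f w)%:E = \int[P]_w (g w)%:E)%E.
Proof.
move=> f0 g0 fg; apply/eqP; rewrite eq_le; apply/andP.
by split; apply: le_integral_ae => [x|x|]; rewrite ?lee_fin//;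
  apply: filterS Ygp => w /fg ->.
Qed.

End WeylCones.

Theorem proposition1p13 (disp : measure_display) (T : measurableType disp)
    (R : realType) (P : probability T R) (d n : nat) (hd : (2 <= d)%N)
    (Y : 'I_n -> {RV P >-> borel_rV R d})
    (Yexch : exchangeable Y)
    (Ygp : {ae P, forall w, general_position_A (sample Y w)})
    (B : set (set 'rV[R]_d)) (hB : cone_borel B) :
  dual_weyl_cone_law Y B =
  weyl_cone_law Y (polyhedral_cone `&` dual_cone @^-1` B).
Proof.
have [w0 gp0] : exists w0, general_position_A (sample Y w0).
  apply: contrapT => ngp; case: Ygp => N [mN N0 sub].
  have NT : N = setT by apply/seteqP; split=> // w _; apply: sub => wgp; apply: ngp; exists w.
  by have := probability_setT P; rewrite -NT => /eqP; rewrite N0 eq_sym onee_eq0.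
have n2 : (2 <= n)%N by have := gp0.1; lia.
pose N := #|[pred s : 'S_n | `[< chamber (sample Y w0 \o s) !=set0 >]]|.
have hP : cone_borel (@polyhedral_cone R d).
  have [c0 cD _] := smallest_sigma_algebra (@polyhedral_cone R d) cone_open.
  by have := cD _ c0; rewrite setD0.
have f0 B' w : 0 <= \sum_(s : 'S_n) (\1_(proper_hull_in Y B' s) w : R).
  by apply: sumr_ge0 => s _; rewrite indicE.
have qN : (n`!%:R%:E * P (proper_hull_in Y polyhedral_cone 1%g) = N%:R%:E)%E.
  rewrite -(integral_sum_proper_hull Yexch hP).
  rewrite (integral_ae_eq Ygp (f0 _) (g := fun=> N%:R))// => [|w wgp].
    rewrite (integral_cst P measurableT (N%:R%:E)).
    by apply: etrans (congr1 _ (probability_setT P)) _; rewrite mule1.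
  rewrite /N (card_chambers_general_position gp0 wgp) -sum1_card natr_sum.
  rewrite [RHS]big_mkcond; apply: eq_bigr => s _.
  have hT := pos_hull_neqTE s n2 wgp.
  rewrite indicE inE; case: asboolP => [/hT hs|hs].
    by rewrite mem_set//; split=> //; exact: polyhedral_pos_hull.
  by rewrite memNset// => -[_ /hT].
have weylE : weyl_cone_law Y (polyhedral_cone `&` dual_cone @^-1` B) =
   ((N%:R^-1)%:E * (n`!%:R%:E * P (proper_hull_in Y B 1%g)))%E.
  rewrite /weyl_cone_law expectation.unlock.
  rewrite (integral_ae_eq Ygp
      (g := fun w => N%:R^-1 * \sum_(s : 'S_n) (\1_(proper_hull_in Y B s) w : R))).
  - under eq_integral do rewrite EFinM.
    rewrite ge0_integralZl_EFin ?invr_ge0//; last 2 first.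
    + by move=> w _; rewrite lee_fin.
    + apply/measurable_EFinP; apply: measurable_sum => s.
      by apply: measurable_indic; exact: measurable_proper_hull_in.
    by rewrite integral_sum_proper_hull.
  - move=> w; rewrite mulr_ge0 ?invr_ge0// big_weyl_tessellation.
    by apply: sumr_ge0 => s _; rewrite indicE.
  - by move=> w; rewrite mulr_ge0 ?invr_ge0.
  - move=> w wgp; rewrite (sum_weyl_tessellation_dual n2 B wgp).
    by rewrite card_weyl_tessellation (card_chambers_general_position wgp gp0).
have hull1 w : hull Y 1%g w = pos_hull (consec_diff (sample Y w)).
  by congr (pos_hull (consec_diff _)); apply/funext => i /=; rewrite perm1.
have pE : P [set w | B (pos_hull (consec_diff (sample Y w))) /\
     pos_hull (consec_diff (sample Y w)) <> setT] = P (proper_hull_in Y B 1%g).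
  by congr (P _); apply/funext => w; rewrite /proper_hull_in /= hull1.
have qE : P [set w | pos_hull (consec_diff (sample Y w)) <> setT] =
    P (proper_hull_in Y polyhedral_cone 1%g).
  congr (P _); apply/seteqP; split=> w; rewrite /proper_hull_in /= hull1; last by case.
  by move=> hT; split=> //; exact: polyhedral_pos_hull.
rewrite weylE /dual_weyl_cone_law pE qE {pE qE weylE}.
have mA B' (hB' : cone_borel B') := measurable_proper_hull_in Y 1%g hB'.
have le_pq : (P (proper_hull_in Y B 1%g) <=
    P (proper_hull_in Y polyhedral_cone 1%g))%E.
  apply: le_measure; rewrite ?inE; try exact: mA.
  by move=> w [_ hT]; split=> //; exact: polyhedral_pos_hull.
have pfin := fin_num_measure P _ (mA _ hB).
have qfin := fin_num_measure P _ (mA _ hP).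
have p0 : (0 <= P (proper_hull_in Y B 1%g))%E by [].
move: qN le_pq p0; rewrite -(fineK pfin) -(fineK qfin).
move: (fine _) (fine _) => p q; rewrite lee_fin -!EFinM => -[qN] pq; rewrite lee_fin => p0.
have nf0 : n`!%:R != 0 :> R by rewrite pnatr_eq0 -lt0n fact_gt0.
have [q0|q0] := eqVneq q 0.
  (* the inverse of [0] is [+oo], which a null numerator cancels *)
  have -> : p = 0 by apply/le_anti; rewrite p0 -q0 pq.
  by rewrite mulr0 mulr0 mul0e.
rewrite inver (negbTE q0) -EFinM -qN; congr EFin.
by field; rewrite nf0 q0.
Qed.
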